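(* Let $\mathcal{C}$ be a category with an initial object, finite limits, finite colimits, covers, and a distinguished collection of morphisms. Let $h^\ast=\{h^n,\delta^n\}_{n\in\mathbb{Z}}:\mathcal{R}\mathcal{C}^2\to\mathcal{A}$ be an $\mathcal{A}$-multiplicative cohomology theory on $\mathcal{C}$. Then for any morphism $f:X\to Y$ in $\mathcal{C}$, $$\mathrm{nil}\left(\mathrm{Ker}\left(f^\ast:h^\ast(Y)\to h^\ast(X)\right)\right)\leq\mathcal{R}\text{-}\mathrm{sec}(f).$$
   Context: Covers. A sieve on an object $C$ of $\mathcal{C}$ is a class $S$ of morphisms with codomain $C$ such that $f\in S$ implies $f\circ g\in S$ for all $g$ with $\mathrm{codom}(g)=\mathrm{dom}(f)$. The sieve generated by $\{f_i:C_i\to C\}_i$ consists of all $g:D\to C$ factoring as $D\to C_i\xrightarrow{f_i}C$ for some $i$. A category with covers is a category with an assignment to each object $C$ of a collection of sieves on $C$, called covering sieves (no axioms required); a family $\{f_i:C_i\to C\}_i$ is a covering for $C$ if it generates a covering sieve. Lim-colim construction. For a finite family $i_\ell:A_\ell\to X$, $1\le\ell\le k$, let $L=\lim_{1\le\ell\le k} i_\ell$ be the limit of the diagram consisting of all the $i_\ell$ (the $k$-fold fibre product of the $A_\ell$ over $X$), with projections $\lambda_\ell:L\to A_\ell$ and $\lambda_\ast:L\to X$, $\lambda_\ast=i_\ell\circ\lambda_\ell$. Let $\widetilde{\lim}_{1\le\ell\le k}\, i_\ell$ be the colimit of the diagram consisting of the morphisms $\lambda_\ell:L\to A_\ell$,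 with structure maps $\rho_\ell:A_\ell\to\widetilde{\lim}\, i_\ell$, $\rho_\ast:L\to\widetilde{\lim}\, i_\ell$. There is a unique $\phi:\widetilde{\lim}\, i_\ell\to X$ with $\phi\circ\rho_\ell=i_\ell$ for all $\ell$ and $\phi\circ\rho_\ast=\lambda_\ast$. A family of morphisms $f_\ell:X\to X'$ all equal to one morphism, together with maps $A_\ell\to A'_\ell$ compatible with $i_\ell:A_\ell\to X$ and $i'_\ell:A'_\ell\to X'$, induces by the universal properties a unique morphism $\xi:\widetilde{\lim}\, i_\ell\to\widetilde{\lim}\, i'_\ell$ compatible with the structure maps. For $i_\ell:A_\ell\to X_\ell$ ($1\le\ell\le k$), put $A^\ell=X_1\times\cdots\times X_{\ell-1}\times A_\ell\times X_{\ell+1}\times\cdots\times X_k$ and $i^\ell=1_{X_1}\times\cdots\times i_\ell\times\cdots\times 1_{X_k}:A^\ell\to\prod_{\ell=1}^k X_\ell$. Distinguished morphisms. With $I$ the initial object, a collection of morphisms is distinguished if: (1) $I\to X$ is distinguished for each $X$; (2) any morphism $A\to X$ belonging to a covering of $X$ is distinguished; (3) finite products of distinguished morphisms are distinguished; (4) if $i_1:A_1\to X,\ldots,i_k:A_k\to X$ are distinguished, so is $\phi:\widetilde{\lim}\, i_\ell\to X$. For distinguished $i_\ell:A_\ell\to X_\ell$, the morphisms $i^\ell$ (and hence $\phi:\widetilde{\lim}\, i^\ell\to\prod_\ell X_\ell$) are also taken to be distinguished. Pairs. $\mathcal{C}^2$ is the category of pairs $(X,A)=(X,A\xrightarrow{i}X)$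 with $i$ distinguished; a morphism $(f,f_|):(X,A\xrightarrow{i}X)\to(Y,B\xrightarrow{j}Y)$ consists of $f:X\to Y$ and $f_|:A\to B$ with $f\circ i=j\circ f_|$ (also written $f$). An object $X$ is identified with $(X,I\to X)$, so morphisms $X\to Y$ of $\mathcal{C}$ are morphisms of pairs. The restriction functor sends $(X,A)$ to $A$ and $f$ to $f_|$. $\mathcal{R}$ is an equivalence relation on each set $\mathrm{Mor}_{\mathcal{C}^2}((X,A),(Y,B))$ that preserves composition ($f\mathcal{R}h$ and $f'\mathcal{R}h'$ imply $(f\circ f')\mathcal{R}(h\circ h')$ for composable morphisms) and such that $f\mathcal{R}g$ implies $f_|\mathcal{R}g_|$. $\mathcal{R}\mathcal{C}^2$ has the objects of $\mathcal{C}^2$ and $\mathcal{R}$-equivalence classes $[f]$ as morphisms; $R:\mathcal{R}\mathcal{C}^2\to\mathcal{R}\mathcal{C}^2$ is the induced restriction functor, $(X,A)\mapsto A$, $[f]\mapsto[f_|]$. Cohomology theory. Let $\mathcal{A}$ be the category of abelian groups or of modules (over a fixed commutative ring). An $\mathcal{A}$-cohomology theory $h^\ast$ on $\mathcal{C}$ consists of contravariant functors $h^n:\mathcal{R}\mathcal{C}^2\to\mathcal{A}$ and natural transformations $\delta^n:h^n\circ R\to h^{n+1}$, $n\in\mathbb{Z}$, such that (writing $f^\ast=h^n[f]$): (C1) for each pair $(X,A\xrightarrow{i}X)$ the sequence $\cdots\to h^{n-1}(A)\xrightarrow{\delta}h^n(X,A)\xrightarrow{\iota^\ast}h^n(X)\xrightarrow{i^\ast}h^n(A)\xrightarrow{\delta}\cdots$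 is exact, where $\iota:X\to(X,A)$ is given by $1_X$; (C2) if $\{i_\ell:A_\ell\to X\}_{\ell=1}^k$ is a finite covering of $X$, then $h^n(X,\widetilde{\lim}_{1\le\ell\le k}\, i_\ell)=0$ for all $n\in\mathbb{Z}$. Multiplicativity. $h^\ast$ is multiplicative if for all $k\ge2$, $m_1,\ldots,m_k\in\mathbb{Z}$ and pairs $(X_\ell,A_\ell\xrightarrow{i_\ell}X_\ell)$, $1\le\ell\le k$, there is a homomorphism $$\mu_{m_1,\ldots,m_k}:h^{m_1}(X_1,A_1)\otimes\cdots\otimes h^{m_k}(X_k,A_k)\to h^{m_1+\cdots+m_k}\Big(\prod_{\ell=1}^kX_\ell,\widetilde{\lim}_{1\le\ell\le k}\, i^\ell\Big)$$ such that: (1) naturality: for morphisms of pairs $f_\ell:(X_\ell,A_\ell)\to(X'_\ell,A'_\ell)$, $(f_1\times\cdots\times f_k)^\ast\circ\mu=\mu\circ(f_1^\ast\otimes\cdots\otimes f_k^\ast)$, where $f_1\times\cdots\times f_k$ denotes the morphism of pairs whose restriction is induced by the maps $f^\ell=f_1\times\cdots\times f_{\ell|}\times\cdots\times f_k:A^\ell\to(A')^\ell$; (2) commutativity: for $i\ne j$, $\mu_{\ldots,m_i,\ldots,m_j,\ldots}=T^\ast\circ\mu_{\ldots,m_j,\ldots,m_i,\ldots}\circ t$, where $t$ interchanges the $i$-th and $j$-th tensor factors with sign $(-1)^{m_im_j}$ and $T$ is the isomorphism of pairs interchanging the $i$-th and $j$-th product factors. Cup product. For pairs $(X,A_\ell\xrightarrow{i_\ell}X)$,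 $1\le \ell\le k$, the diagonal $\Delta:X\to\prod_{\ell=1}^kX$ together with the maps $\Delta_\ell:A_\ell\to A^\ell$ (with $\ell$-th component $1_{A_\ell}$ and all other components $i_\ell$) induces a morphism of pairs $\Delta:(X,\widetilde{\lim}\, i_\ell)\to(\prod_{\ell=1}^k X,\widetilde{\lim}\, i^\ell)$, and the cup product is $x_1\cup\cdots\cup x_k=\Delta^\ast\mu(x_1\otimes\cdots\otimes x_k)\in h^{m_1+\cdots+m_k}(X,\widetilde{\lim}\, i_\ell)$ for $x_\ell\in h^{m_\ell}(X,A_\ell)$. For absolute classes $x_\ell\in h^{m_\ell}(X)=h^{m_\ell}(X,I)$ the product is taken in $h^{m_1+\cdots+m_k}(X)$, using $\Delta$ as a morphism of pairs $(X,I)\to(\prod_{\ell=1}^k X,\widetilde{\lim}\,(i_I)^\ell)$, where $i_I:I\to X$. A product of one element is the element itself. Put $h^\ast(X)=\bigoplus_n h^n(X)$, with products extended multilinearly, and for $S\subset h^\ast(Y)$ let $\mathrm{nil}(S)=\min\{n\ge1:\text{every product }x_1\cup\cdots\cup x_n\text{ of }n\text{ elements of }S\text{ vanishes}\}$ ($\infty$ if there is no such $n$). Sectional number. For $f:X\to Y$ in $\mathcal{C}$, $\mathcal{R}\text{-}\mathrm{sec}(f)$ is the least integer $m\ge1$ such that there is a covering $\{g_j:Y_j\to Y\}_{j=1}^m$ for $Y$ and morphisms $s_j:Y_j\to X$ with $(f\circ s_j)\,\mathcal{R}\,g_j$ for each $j$ (where $\mathcal{R}$ is applied to morphisms of $\mathcal{C}$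 regarded as morphisms of pairs), and $\infty$ if there is no such $m$. *)

(* Defs.v *)
From HB Require Import structures.
From mathcomp Require Import all_boot all_order all_algebra all_fingroup.
From mathcomp Require Import boolp classical_sets functions cardinality.
From mathcomp Require Import fsbigop constructive_ereal.

Set Implicit Arguments.
Unset Strict Implicit.
Unset Printing Implicit Defensive.

Import Order.TTheory GRing.Theory Num.Theory.

Local Open Scope classical_set_scope.
Local Open Scope ring_scope.

Declare Scope cat_scope.
Delimit Scope cat_scope with C.
Local Open Scope cat_scope.

Record category := Category {
  Obj :> Type;
  Mor : Obj -> Obj -> Type;
  idm : forall X, Mor X X;
  compose : forall X Y Z, Mor Y Z -> Mor X Y -> Mor X Z;
  compA : forall W X Y Z (h : Mor Y Z) (g : Mor X Y) (f : Mor W X),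
    compose h (compose g f) = compose (compose h g) f;
  comp1m : forall X Y (f : Mor X Y), compose (idm Y) f = f;
  compm1 : forall X Y (f : Mor X Y), compose f (idm X) = f
}.
Arguments Mor {c} _ _.
Arguments idm {c} _.
Arguments compose {c} {X Y Z} _ _.
Notation "g ∘ f" := (compose g f) (at level 40, left associativity) : cat_scope.

Definition opposite (C : category) : category :=
  @Category C (fun X Y => @Mor C Y X) (fun X => idm X)
    (fun X Y Z g f => f ∘ g)
    (fun W X Y Z h g f => esym (compA f g h))
    (fun X Y f => compm1 f) (fun X Y f => comp1m f).

Record functor (C D : category) := Functor {
  fobj :> C -> D;
  fmap : forall X Y, Mor X Y -> Mor (fobj X) (fobj Y);
  fmap_id : forall X, fmap (idm X) = idm (fobj X);
  fmap_comp : forall X Y Z (g : Mor Y Z) (f : Mor X Y),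
    fmap (g ∘ f) = fmap g ∘ fmap f
}.
Arguments fmap {C D} _ {X Y} _.

Definition functor_op (C D : category) (F : functor C D) :
    functor (opposite C) (opposite D) :=
  @Functor (opposite C) (opposite D) F (fun X Y f => @fmap C D F Y X f)
    (fun X => fmap_id F X) (fun X Y Z g f => fmap_comp F f g).

Definition functor_comp (C D E : category) (G : functor D E) (F : functor C D) :
  functor C E.
Proof.
refine (@Functor C E (fun X => G (F X)) (fun X Y f => fmap G (fmap F f)) _ _).
- by move=> X; rewrite !fmap_id.
- by move=> X Y Z g f; rewrite !fmap_comp.
Defined.

Record nat_trans (C D : category) (F G : functor C D) := NatTrans {
  component :> forall X : C, Mor (F X) (G X);
  naturality : forall X Y (f : Mor X Y),
    component Y ∘ fmap F f = fmap G f ∘ component X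
}.

Lemma linear_ext (K : comPzRingType) (U V : lmodType K)
  (f g : {linear U -> V}) : f =1 g -> f = g.
Proof.
move=> /funext; case: f g => [f cf] [g cg] /= fg; move: cf cg.
rewrite {}fg => cf cg; congr GRing.Linear.Pack.
case: cf cg => [[a] [b]] [[c] [d]].
by rewrite (Prop_irrelevance a c) (Prop_irrelevance b d).
Qed.

Definition linear_comp (K : comPzRingType) (U V W : lmodType K)
  (g : {linear V -> W}) (f : {linear U -> V}) : {linear U -> W} := (g \o f)%FUN.

Definition linear_id (K : comPzRingType) (U : lmodType K) : {linear U -> U} :=
  idfun.

(** Abelian groups are the case [K = int]. *)
Definition modules (K : comPzRingType) : category.
Proof.
refine (@Category (lmodType K) (fun U V => {linear U -> V})
  (@linear_id K) (@linear_comp K) _ _ _).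
- by move=> *; apply: linear_ext.
- by move=> *; apply: linear_ext.
- by move=> *; apply: linear_ext.
Defined.

Record initial (C : category) := Initial {
  init :> C;
  from_init : forall X, Mor init X;
  from_init_uniq : forall X (f g : Mor init X), f = g
}.
Arguments from_init {C} _ X.

(** A diagram is indexed by a finite graph.  Having limits of all such diagrams
    is the same as having limits of all functors from finite categories (both
    amount to finite products and equalizers), and dually. *)
Record diagram (C : category) := Diagram {
  vertex : finType;
  edge : finType;
  src : edge -> vertex;
  tgt : edge -> vertex;
  dobj : vertex -> C;
  dmor : forall e, Mor (dobj (src e)) (dobj (tgt e))
}.
Arguments src {C} d e.
Arguments tgt {C} d e.
Arguments dobj {C} d v.
Arguments dmor {C} d e.

Definition is_cone (C : category) (D : diagram C) (Z : C)
  (q : forall v, Mor Z (dobj D v)) : Prop :=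
  forall e, dmor D e ∘ q (src D e) = q (tgt D e).

Definition is_cocone (C : category) (D : diagram C) (Z : C)
  (q : forall v, Mor (dobj D v) Z) : Prop :=
  forall e, q (tgt D e) ∘ dmor D e = q (src D e).

Record limit (C : category) (D : diagram C) := Limit {
  lim_obj :> C;
  lim_proj : forall v, Mor lim_obj (dobj D v);
  lim_cone : is_cone lim_proj;
  lim_lift : forall Z (q : forall v, Mor Z (dobj D v)), is_cone q -> Mor Z lim_obj;
  lim_liftE : forall Z (q : forall v, Mor Z (dobj D v)) (qP : is_cone q) v,
    lim_proj v ∘ lim_lift qP = q v;
  lim_uniq : forall Z (u u' : Mor Z lim_obj),
    (forall v, lim_proj v ∘ u = lim_proj v ∘ u') -> u = u'
}.

Record colimit (C : category) (D : diagram C) := Colimit {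
  colim_obj :> C;
  colim_inj : forall v, Mor (dobj D v) colim_obj;
  colim_cocone : is_cocone colim_inj;
  colim_desc : forall Z (q : forall v, Mor (dobj D v) Z),
    is_cocone q -> Mor colim_obj Z;
  colim_descE : forall Z (q : forall v, Mor (dobj D v) Z) (qP : is_cocone q) v,
    colim_desc qP ∘ colim_inj v = q v;
  colim_uniq : forall Z (u u' : Mor colim_obj Z),
    (forall v, u ∘ colim_inj v = u' ∘ colim_inj v) -> u = u'
}.

Definition finite_limits (C : category) := forall D : diagram C, limit D.
Definition finite_colimits (C : category) := forall D : diagram C, colimit D.

Record sieve (C : category) (X : C) := Sieve {
  in_sieve :> forall D, Mor D X -> Prop;
  sieve_closed : forall D E (f : Mor D X) (g : Mor E D),
    in_sieve f -> in_sieve (f ∘ g)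
}.

Definition generated_sieve (C : category) (X : C) (T : Type) (A : T -> C)
  (f : forall t, Mor (A t) X) : sieve X.
Proof.
refine (@Sieve C X
  (fun D g => exists t, exists u : Mor D (A t), g = f t ∘ u) _).
by move=> D E _ g [t [u ->]]; exists t, (u ∘ g); rewrite compA.
Defined.

Definition covers (C : category) := forall X : C, sieve X -> Prop.

Definition covering (C : category) (J : covers C) (X : C) (T : Type)
  (A : T -> C) (f : forall t, Mor (A t) X) : Prop :=
  J X (generated_sieve f).

Section LimColim.
Variables (C : category) (Lim : finite_limits C) (Colim : finite_colimits C).

Definition discrete_diagram k (X : 'I_k -> C) : diagram C :=
  @Diagram C 'I_k void (of_void _) (of_void _) X
    (fun e => match e with end).

Definition prod_obj k (X : 'I_k -> C) : C := Lim (discrete_diagram X).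

Definition prod_proj k (X : 'I_k -> C) l : Mor (prod_obj X) (X l) :=
  lim_proj (Lim (discrete_diagram X)) l.

Lemma discrete_cone k (X : 'I_k -> C) Z (q : forall l, Mor Z (X l)) :
  is_cone (D := discrete_diagram X) q.
Proof. by case. Qed.

Definition prod_tuple k (X : 'I_k -> C) Z (q : forall l, Mor Z (X l)) :
  Mor Z (prod_obj X) := lim_lift (Lim _) (discrete_cone q).

Lemma prod_tupleE k (X : 'I_k -> C) Z (q : forall l, Mor Z (X l)) l :
  prod_proj X l ∘ prod_tuple q = q l.
Proof. exact: (lim_liftE _ (discrete_cone q) l). Qed.

Lemma prod_uniq k (X : 'I_k -> C) Z (u u' : Mor Z (prod_obj X)) :
  (forall l, prod_proj X l ∘ u = prod_proj X l ∘ u') -> u = u'.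
Proof. exact: (@lim_uniq _ _ (Lim (discrete_diagram X))). Qed.

Definition prod_map k (X Y : 'I_k -> C) (f : forall l, Mor (X l) (Y l)) :
  Mor (prod_obj X) (prod_obj Y) := prod_tuple (fun l => f l ∘ prod_proj X l).

Definition diagonal k (X : C) : Mor X (prod_obj (fun _ : 'I_k => X)) :=
  prod_tuple (fun _ => idm X).

(** In the next diagram the vertex [None] carries [X], in the one after it
    the vertex [None] carries [L]. *)
Definition sink_diagram k (A : 'I_k -> C) (X : C)
    (i : forall l, Mor (A l) X) : diagram C :=
  @Diagram C (option 'I_k) 'I_k (@Some _) (fun _ => None)
    (fun v => if v is Some l then A l else X) i.

Definition source_diagram k (L : C) (A : 'I_k -> C)
    (p : forall l, Mor L (A l)) : diagram C :=
  @Diagram C (option 'I_k) 'I_k (fun _ => None) (@Some _)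
    (fun v => if v is Some l then A l else L) p.

Section OneFamily.
Variables (k : nat) (A : 'I_k -> C) (X : C) (i : forall l, Mor (A l) X).

Definition fibre_prod : C := Lim (sink_diagram i).

Definition lambda l : Mor fibre_prod (A l) :=
  lim_proj (Lim (sink_diagram i)) (Some l).
Definition lambda_star : Mor fibre_prod X :=
  lim_proj (Lim (sink_diagram i)) None.

Lemma lambdaE l : i l ∘ lambda l = lambda_star.
Proof. exact: (lim_cone (Lim (sink_diagram i)) l). Qed.

Definition limtilde : C := Colim (source_diagram lambda).

Definition rho l : Mor (A l) limtilde :=
  colim_inj (Colim (source_diagram lambda)) (Some l).
Definition rho_star : Mor fibre_prod limtilde :=
  colim_inj (Colim (source_diagram lambda)) None.

Lemma rhoE l : rho l ∘ lambda l = rho_star.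
Proof. exact: (colim_cocone (Colim (source_diagram lambda)) l). Qed.

Lemma phi_cocone : is_cocone (D := source_diagram lambda)
  (fun v => match v return Mor (dobj (source_diagram lambda) v) X with
            | Some l => i l | None => lambda_star end).
Proof. exact: lambdaE. Qed.

Definition phi : Mor limtilde X := colim_desc (Colim _) phi_cocone.

Lemma phi_rho l : phi ∘ rho l = i l.
Proof. exact: (colim_descE _ phi_cocone (Some l)). Qed.

Lemma phi_rho_star : phi ∘ rho_star = lambda_star.
Proof. exact: (colim_descE _ phi_cocone None). Qed.

Lemma limtilde_uniq Z (u u' : Mor limtilde Z) :
  (forall l, u ∘ rho l = u' ∘ rho l) ->
  u ∘ rho_star = u' ∘ rho_star -> u = u'.
Proof. by move=> h1 h2; apply: colim_uniq => -[l|]; [exact: h1|exact: h2]. Qed.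

End OneFamily.

Section Xi.
Variables (k : nat) (A A' : 'I_k -> C) (X X' : C).
Variables (i : forall l, Mor (A l) X) (i' : forall l, Mor (A' l) X').
Variables (f : Mor X X') (a : forall l, Mor (A l) (A' l)).
Hypothesis comm : forall l, f ∘ i l = i' l ∘ a l.

Lemma xi_cone : is_cone (D := sink_diagram i')
  (fun v => match v return Mor (fibre_prod i) (dobj (sink_diagram i') v) with
            | Some l => a l ∘ lambda i l | None => f ∘ lambda_star i end).
Proof. by move=> l /=; rewrite compA -comm -compA lambdaE. Qed.

Definition fibre_prod_map : Mor (fibre_prod i) (fibre_prod i') :=
  lim_lift (Lim _) xi_cone.

Lemma fibre_prod_mapE l : lambda i' l ∘ fibre_prod_map = a l ∘ lambda i l.
Proof. exact: (lim_liftE _ xi_cone (Some l)). Qed.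

Lemma xi_cocone : is_cocone (D := source_diagram (lambda i))
  (fun v => match v return Mor (dobj (source_diagram (lambda i)) v)
                               (limtilde i') with
            | Some l => rho i' l ∘ a l
            | None => rho_star i' ∘ fibre_prod_map end).
Proof. by move=> l /=; rewrite -compA -fibre_prod_mapE compA rhoE. Qed.

Definition xi : Mor (limtilde i) (limtilde i') := colim_desc (Colim _) xi_cocone.

Lemma xi_rho l : xi ∘ rho i l = rho i' l ∘ a l.
Proof. exact: (colim_descE _ xi_cocone (Some l)). Qed.

Lemma xi_rho_star : xi ∘ rho_star i = rho_star i' ∘ fibre_prod_map.
Proof. exact: (colim_descE _ xi_cocone None). Qed.

Lemma phi_xi : phi i' ∘ xi = f ∘ phi i.
Proof.
have L0 : lambda_star i' ∘ fibre_prod_map = f ∘ lambda_star i.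
  exact: (lim_liftE _ xi_cone None).
apply: limtilde_uniq => [l|].
  by rewrite -!compA xi_rho phi_rho compA phi_rho comm.
by rewrite -!compA xi_rho_star phi_rho_star compA phi_rho_star L0.
Qed.

End Xi.

(** The canonical isomorphism between the lim-colim of a family and the one of
    the same family listed in another order, given by an involution [s]. *)
Section Reorder.
Variables (k : nat) (A : 'I_k -> C) (X : C) (i : forall l, Mor (A l) X).
Variables (s : 'I_k -> 'I_k) (sK : involutive s).

Let i' l : Mor (A (s l)) X := i (s l).

Lemma reorder_cone : is_cone (D := sink_diagram i')
  (fun v => match v return Mor (fibre_prod i) (dobj (sink_diagram i') v) with
            | Some l => lambda i (s l) | None => lambda_star i end).
Proof. by move=> l /=; exact: lambdaE. Qed.

Definition fibre_prod_reorder : Mor (fibre_prod i) (fibre_prod i') :=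
  lim_lift (Lim _) reorder_cone.

Definition rho_reorder l : Mor (A l) (limtilde i') :=
  eq_rect (s (s l)) (fun l' => Mor (A l') (limtilde i')) (rho i' (s l)) l (sK l).

Lemma cast_dom_comp Y Z (l l' : 'I_k) (e : l = l') (u : Mor (A l) Z)
    (v : forall l, Mor Y (A l)) :
  eq_rect l (fun j => Mor (A j) Z) u l' e ∘ v l' = u ∘ v l.
Proof. by case: _ / e. Qed.

Lemma comp_cast_dom Y Z (l l' : 'I_k) (e : l = l') (u : Mor (A l) Y)
    (w : Mor Y Z) (v : forall l, Mor (A l) Z) :
  w ∘ u = v l -> w ∘ eq_rect l (fun j => Mor (A j) Y) u l' e = v l'.
Proof. by case: _ / e. Qed.

Lemma reorder_cocone : is_cocone (D := source_diagram (lambda i))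
  (fun v => match v return Mor (dobj (source_diagram (lambda i)) v)
                               (limtilde i') with
            | Some l => rho_reorder l
            | None => rho_star i' ∘ fibre_prod_reorder end).
Proof.
move=> l /=; have -> : rho_reorder l ∘ lambda i l =
    rho i' (s l) ∘ lambda i (s (s l)).
  exact: cast_dom_comp.
rewrite -(rhoE i' (s l)) -compA; congr (_ ∘ _).
exact/esym/(lim_liftE _ reorder_cone (Some (s l))).
Qed.

Definition limtilde_reorder : Mor (limtilde i) (limtilde i') :=
  colim_desc (Colim _) reorder_cocone.

Lemma phi_reorder : phi i' ∘ limtilde_reorder = phi i.
Proof.
apply: limtilde_uniq => [l|]; rewrite -compA.
  have -> : limtilde_reorder ∘ rho i l = rho_reorder l.
    exact: (colim_descE _ reorder_cocone (Some l)).
  by rewrite phi_rho; apply: comp_cast_dom; rewrite phi_rho.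
have -> : limtilde_reorder ∘ rho_star i = rho_star i' ∘ fibre_prod_reorder.
  exact: (colim_descE _ reorder_cocone None).
rewrite compA !phi_rho_star; exact: (lim_liftE _ reorder_cone None).
Qed.

End Reorder.

(** [up_obj A X l] is the product [A^l] in which only the factor [l] of the
    product of the [X j] is replaced by [A l], and [up_mor i l] is the morphism
    [i^l] from it to the product of the [X j]. *)
Definition up_factor k (A X : 'I_k -> C) (l j : 'I_k) : C :=
  if j == l then A j else X j.

Definition up_obj k (A X : 'I_k -> C) (l : 'I_k) : C :=
  prod_obj (up_factor A X l).

Definition up_factor_mor k (A X : 'I_k -> C) (i : forall j, Mor (A j) (X j))
    (l j : 'I_k) : Mor (up_factor A X l j) (X j) :=
  match j == l as b return Mor (if b then A j else X j) (X j) with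
  | true => i j | false => idm (X j)
  end.

Definition up_mor k (A X : 'I_k -> C) (i : forall j, Mor (A j) (X j))
    (l : 'I_k) : Mor (up_obj A X l) (prod_obj X) :=
  prod_map (up_factor_mor i l).

(** The map [f^l = f_1 x ... x f_l| x ... x f_k], where [a j] is [f_j|]. *)
Definition up_factor_map k (A X A' X' : 'I_k -> C)
    (f : forall j, Mor (X j) (X' j)) (a : forall j, Mor (A j) (A' j))
    (l j : 'I_k) : Mor (up_factor A X l j) (up_factor A' X' l j) :=
  match j == l as b return Mor (if b then A j else X j)
                               (if b then A' j else X' j) with
  | true => a j | false => f j
  end.

Definition up_map k (A X A' X' : 'I_k -> C)
    (f : forall j, Mor (X j) (X' j)) (a : forall j, Mor (A j) (A' j))
    (l : 'I_k) : Mor (up_obj A X l) (up_obj A' X' l) :=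
  prod_map (up_factor_map f a l).

Lemma up_map_comm k (A X A' X' : 'I_k -> C)
    (i : forall j, Mor (A j) (X j)) (i' : forall j, Mor (A' j) (X' j))
    (f : forall j, Mor (X j) (X' j)) (a : forall j, Mor (A j) (A' j)) :
  (forall j, f j ∘ i j = i' j ∘ a j) ->
  forall l, prod_map f ∘ up_mor i l = up_mor i' l ∘ up_map f a l.
Proof.
move=> comm l; apply: prod_uniq => j; rewrite !compA !prod_tupleE -!compA.
rewrite !prod_tupleE !compA; congr (_ ∘ _).
rewrite /up_factor_mor /up_factor_map /up_factor.
by case: (j == l); [exact: comm|rewrite comp1m compm1].
Qed.

Definition prod_reorder k (X : 'I_k -> C) (s : 'I_k -> 'I_k) :
  Mor (prod_obj X) (prod_obj (fun j => X (s j))) :=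
  prod_tuple (fun j => prod_proj X (s j)).

Definition up_reorder_component k (A X : 'I_k -> C) (s : 'I_k -> 'I_k)
    (s_inj : injective s) (l j : 'I_k) :
    Mor (up_obj A X (s l))
        (up_factor (fun j => A (s j)) (fun j => X (s j)) l j) :=
  eq_rect (s j == s l)
    (fun b => Mor (up_obj A X (s l)) (if b then A (s j) else X (s j)))
    (prod_proj (up_factor A X (s l)) (s j)) (j == l) (inj_eq s_inj j l).

Definition up_reorder k (A X : 'I_k -> C) (s : 'I_k -> 'I_k)
    (s_inj : injective s) (l : 'I_k) :
    Mor (up_obj A X (s l)) (up_obj (fun j => A (s j)) (fun j => X (s j)) l) :=
  prod_tuple (up_reorder_component A X s_inj l).

Lemma up_reorder_comm k (A X : 'I_k -> C) (i : forall j, Mor (A j) (X j))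
    (s : 'I_k -> 'I_k) (s_inj : injective s) (l : 'I_k) :
  prod_reorder X s ∘ up_mor i (s l) =
  up_mor (fun j => i (s j)) l ∘ up_reorder A X s_inj l.
Proof.
apply: prod_uniq => j; rewrite !compA !prod_tupleE -compA !prod_tupleE.
rewrite /up_reorder_component /up_factor_mor /up_factor.
by case: _ / (inj_eq s_inj j l).
Qed.

End LimColim.

Record distinguished_class (C : category) (I : initial C)
  (Lim : finite_limits C) (Colim : finite_colimits C) (J : covers C) :=
    DistinguishedClass {
  distinguished :> forall A X : C, Mor A X -> Prop;
  dist_init : forall X, distinguished (from_init I X);
  dist_cover : forall (X : C) (T : Type) (A : T -> C)
    (f : forall t, Mor (A t) X),
    covering J f -> forall t, distinguished (f t);
  dist_prod : forall k (A X : 'I_k -> C) (i : forall l, Mor (A l) (X l)),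
    (0 < k)%N -> (forall l, distinguished (i l)) ->
    distinguished (prod_map Lim i);
  dist_phi : forall k (A : 'I_k -> C) (X : C) (i : forall l, Mor (A l) X),
    (0 < k)%N -> (forall l, distinguished (i l)) ->
    distinguished (phi Lim Colim i);
  dist_up : forall k (A X : 'I_k -> C) (i : forall l, Mor (A l) (X l)),
    (forall l, distinguished (i l)) ->
    forall l, distinguished (up_mor Lim i l)
}.

Section Pairs.
Variables (C : category) (I : initial C).
Variables (Lim : finite_limits C) (Colim : finite_colimits C) (J : covers C).
Variable D : distinguished_class I Lim Colim J.

Record cpair := CPair {
  ptotal : C;
  psub : C;
  pincl : Mor psub ptotal;
  pdist : D _ _ pincl
}.

Record pmor (P Q : cpair) := PMor {
  pmap : Mor (ptotal P) (ptotal Q);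
  prestr : Mor (psub P) (psub Q);
  pcomm : pmap ∘ pincl P = pincl Q ∘ prestr
}.

Lemma pmor_eq P Q (f g : pmor P Q) :
  pmap f = pmap g -> prestr f = prestr g -> f = g.
Proof.
case: f g => [f fr fc] [g gr gc] /= fg frgr; move: fc gc.
by rewrite {}fg {}frgr => fc gc; rewrite (Prop_irrelevance fc gc).
Qed.

Definition pmor_id P : pmor P P.
Proof.
by refine (@PMor P P (idm _) (idm _) _); rewrite comp1m compm1.
Defined.

Definition pmor_comp P Q S (g : pmor Q S) (f : pmor P Q) : pmor P S.
Proof.
refine (@PMor P S (pmap g ∘ pmap f) (prestr g ∘ prestr f) _).
by rewrite -compA pcomm !compA pcomm.
Defined.

Definition pairs : category.
Proof.
refine (@Category cpair pmor pmor_id pmor_comp _ _ _).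
- by move=> *; apply: pmor_eq; apply: compA.
- by move=> *; apply: pmor_eq; apply: comp1m.
- by move=> *; apply: pmor_eq; apply: compm1.
Defined.

(** The identification of [X] with the pair [(X, I -> X)]. *)
Definition absolute (X : C) : cpair := CPair (dist_init D X).

Definition abs_mor (X Y : C) (f : Mor X Y) : pmor (absolute X) (absolute Y) :=
  @PMor (absolute X) (absolute Y) f (idm I) (from_init_uniq _ _).

(** A morphism [X -> ptotal Q] of [C], seen as a morphism [(X, I) -> Q]. *)
Definition from_abs (X : C) (Q : cpair) (f : Mor X (ptotal Q)) :
  pmor (absolute X) Q :=
  @PMor (absolute X) Q f (from_init I (psub Q)) (from_init_uniq _ _).

Definition pair_iota (P : cpair) : pmor (absolute (ptotal P)) P :=
  from_abs (idm (ptotal P)).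

(** The morphism [X -> Y] that the restriction functor assigns to a morphism of
    pairs, again seen as a morphism of pairs. *)
Definition restr (P Q : cpair) (f : pmor P Q) :
  pmor (absolute (psub P)) (absolute (psub Q)) := abs_mor (prestr f).

Record pair_relation := PairRelation {
  prel : forall P Q, pmor P Q -> pmor P Q -> Prop;
  prel_refl : forall P Q (f : pmor P Q), prel f f;
  prel_sym : forall P Q (f g : pmor P Q), prel f g -> prel g f;
  prel_trans : forall P Q (f g h : pmor P Q), prel f g -> prel g h -> prel f h;
  prel_comp : forall P Q S (f h : pmor Q S) (f' h' : pmor P Q),
    prel f h -> prel f' h' -> prel (pmor_comp f f') (pmor_comp h h');
  prel_restr : forall P Q (f g : pmor P Q),
    prel f g -> prel (restr f) (restr g)
}.

Section Quotient.
Variable R : pair_relation.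

Definition rclass P Q : Type :=
  {c : pmor P Q -> Prop | exists f, c = prel R f}.

Definition rcls P Q (f : pmor P Q) : rclass P Q :=
  exist _ (prel R f) (ex_intro _ f erefl).

Lemma rclass_eq P Q (c d : rclass P Q) : sval c = sval d -> c = d.
Proof.
case: c d => [c cP] [d dP] /= cd; move: cP dP.
by rewrite {}cd => cP dP; rewrite (Prop_irrelevance cP dP).
Qed.

Lemma rclassP P Q (c : rclass P Q) : exists f, c = rcls f.
Proof. by case: c => [c [f cf]]; exists f; apply: rclass_eq. Qed.

Lemma cls_eq P Q (f g : pmor P Q) : prel R f g -> rcls f = rcls g.
Proof.
move=> fg; apply: rclass_eq; apply/predeqP => h /=; split=> ?.
  exact: prel_trans (prel_sym fg) _.
exact: prel_trans fg _.
Qed.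

Definition rcomp P Q S (c : rclass Q S) (d : rclass P Q) : rclass P S.
Proof.
exists (fun h => exists f g,
  [/\ sval c f, sval d g & prel R (pmor_comp f g) h]).
have [[f ->] [g ->]] := (rclassP c, rclassP d).
exists (pmor_comp f g); apply/predeqP => h /=; split.
  move=> [f' [g' [ff' gg']]]; apply: prel_trans.
  exact: prel_comp.
by move=> fgh; exists f, g; split=> //; exact: prel_refl.
Defined.

Lemma cls_comp P Q S (f : pmor Q S) (g : pmor P Q) :
  rcomp (rcls f) (rcls g) = rcls (pmor_comp f g).
Proof.
apply: rclass_eq; apply/predeqP => h /=; split.
  move=> [f' [g' [ff' gg']]]; apply: prel_trans.
  exact: prel_comp.
by move=> fgh; exists f, g; split=> //; exact: prel_refl.
Qed.

Definition rpairs : category.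
Proof.
refine (@Category cpair rclass (fun P => rcls (pmor_id P)) rcomp _ _ _).
- move=> W X Y Z h g f; have [h' ->] := rclassP h.
  have [[g' ->] [f' ->]] := (rclassP g, rclassP f).
  by rewrite !cls_comp; congr rcls; apply: (@compA pairs).
- move=> X Y f; have [f' ->] := rclassP f.
  by rewrite cls_comp; congr rcls; apply: (@comp1m pairs).
- move=> X Y f; have [f' ->] := rclassP f.
  by rewrite cls_comp; congr rcls; apply: (@compm1 pairs).
Defined.

Definition rrestr P Q (c : rclass P Q) :
  rclass (absolute (psub P)) (absolute (psub Q)).
Proof.
exists (fun h => exists2 f, sval c f & prel R (restr f) h).
have [f ->] := rclassP c; exists (restr f); apply/predeqP => h /=; split.
  by move=> [g fg]; apply: prel_trans; exact: prel_restr.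
by move=> fh; exists f => //; exact: prel_refl.
Defined.

Lemma rrestr_cls P Q (f : pmor P Q) : rrestr (rcls f) = rcls (restr f).
Proof.
apply: rclass_eq; apply/predeqP => h /=; split.
  by move=> [g fg]; apply: prel_trans; exact: prel_restr.
by move=> fh; exists f => //; exact: prel_refl.
Qed.

Definition restriction : functor rpairs rpairs.
Proof.
refine (@Functor rpairs rpairs (fun P => absolute (psub P)) rrestr _ _).
- move=> P /=; rewrite rrestr_cls; congr rcls; exact: pmor_eq.
- move=> P Q S g f /=; have [[g' ->] [f' ->]] := (rclassP g, rclassP f).
  rewrite cls_comp !rrestr_cls cls_comp; congr rcls.
  by apply: pmor_eq => //=; rewrite comp1m.
Defined.

End Quotient.

Definition prod_pair k (P : 'I_k.+1 -> cpair) : cpair :=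
  CPair (dist_phi (ltn0Sn k) (dist_up (fun l => pdist (P l)))).

Definition prod_pmor k (P Q : 'I_k.+1 -> cpair) (f : forall l, pmor (P l) (Q l)) :
    pmor (prod_pair P) (prod_pair Q) :=
  @PMor (prod_pair P) (prod_pair Q)
    (prod_map Lim (fun l => pmap (f l)))
    (xi Lim Colim (up_map_comm Lim (fun l => pcomm (f l))))
    (esym (phi_xi Lim Colim (up_map_comm Lim (fun l => pcomm (f l))))).

Definition swap_restr k (P : 'I_k.+1 -> cpair) (s : 'I_k.+1 -> 'I_k.+1)
    (sK : involutive s) :
    Mor (psub (prod_pair P)) (psub (prod_pair (fun l => P (s l)))) :=
  xi Lim Colim (up_reorder_comm Lim (fun l => pincl (P l)) (inv_inj sK))
  ∘ limtilde_reorder Lim Colim (up_mor Lim (fun l => pincl (P l))) sK.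

Lemma swap_comm k (P : 'I_k.+1 -> cpair) (s : 'I_k.+1 -> 'I_k.+1)
    (sK : involutive s) :
  prod_reorder Lim (fun l => ptotal (P l)) s ∘ pincl (prod_pair P) =
  pincl (prod_pair (fun l => P (s l))) ∘ swap_restr P sK.
Proof. by rewrite /swap_restr /= compA phi_xi -compA phi_reorder. Qed.

Definition prod_swap k (P : 'I_k.+1 -> cpair) (s : 'I_k.+1 -> 'I_k.+1)
    (sK : involutive s) :
    pmor (prod_pair P) (prod_pair (fun l => P (s l))) :=
  @PMor (prod_pair P) (prod_pair (fun l => P (s l)))
    (prod_reorder Lim (fun l => ptotal (P l)) s) (swap_restr P sK)
    (swap_comm P sK).

End Pairs.

Section Cohomology.
Variables (C : category) (I : initial C).
Variables (Lim : finite_limits C) (Colim : finite_colimits C) (J : covers C).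
Variables (D : distinguished_class I Lim Colim J) (R : pair_relation D).
Variable K : comPzRingType.

Definition exact_at (U V W : lmodType K) (f : U -> V) (g : V -> W) : Prop :=
  forall v, g v = 0 <-> exists u, f u = v.

Definition finite_cover_pair k (A : 'I_k.+1 -> C) (X : C)
    (i : forall l, Mor (A l) X) (cov : covering J i) : cpair D :=
  CPair (dist_phi (ltn0Sn k) (dist_cover D cov)).

(** Exactness at the relative terms is stated at [h^(n+1)(X, A)], which avoids
    the degree [(n - 1) + 1]. *)
Record cohomology_theory := CohomologyTheory {
  hfun : int -> functor (opposite (rpairs R)) (modules K);
  hdelta : forall n : int,
    nat_trans (functor_comp (hfun n) (functor_op (restriction R)))
              (hfun (n + 1));
  hobj := fun n (P : cpair D) => hfun n P : lmodType K;
  hpull := fun n (P Q : cpair D) (f : pmor P Q) =>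
    fmap (hfun n) (rcls R f : @Mor (opposite (rpairs R)) Q P)
      : {linear hobj n Q -> hobj n P};
  hconn := fun n (P : cpair D) =>
    hdelta n P : {linear hobj n (absolute D (psub P)) -> hobj (n + 1) P};
  h_exact_rel : forall n P, exact_at (hconn n P) (hpull (n + 1) (pair_iota P));
  h_exact_total : forall n P,
    exact_at (hpull n (pair_iota P)) (hpull n (abs_mor D (pincl P)));
  h_exact_sub : forall n P,
    exact_at (hpull n (abs_mor D (pincl P))) (hconn n P);
  h_cover : forall k (A : 'I_k.+1 -> C) (X : C) (i : forall l, Mor (A l) X)
    (cov : covering J i) n (x : hobj n (finite_cover_pair cov)), x = 0
}.

(** Homomorphisms out of a tensor product of the [M t] are given by multilinear
    maps; [dfwith x u] replaces one entry of the family [x] by [u]. *)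
Definition multilinear (T : eqType) (M : T -> lmodType K) (N : lmodType K)
    (F : (forall t, M t) -> N) : Prop :=
  forall (x : forall t, M t) t (a : K) (u v : M t),
    F (dfwith x (a *: u + v)) = a *: F (dfwith x u) + F (dfwith x v).

Lemma sum_swap k (m : 'I_k -> int) (i j : 'I_k) :
  \sum_l m (tperm i j l) = \sum_l m l.
Proof. by rewrite [RHS](reindex_inj (@perm_inj _ (tperm i j))). Qed.

Variable h : cohomology_theory.

Definition cast_degree (m n : int) (P : cpair D) (e : m = n) (x : hobj h m P) :
  hobj h n P := eq_rect m (fun d => hobj h d P) x n e.

(** In [mu_comm] the swap [t] of two tensor factors is precomposition of the
    family [x] with the transposition, and its sign, which involves only the two
    degrees [m i] and [m j], is moved outside the linear maps. *)
Record multiplicative := Multiplicative {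
  mu : forall k (m : 'I_k.+2 -> int) (P : 'I_k.+2 -> cpair D),
    (forall l, hobj h (m l) (P l)) -> hobj h (\sum_l m l) (prod_pair P);
  mu_multilinear : forall k (m : 'I_k.+2 -> int) (P : 'I_k.+2 -> cpair D),
    multilinear (@mu k m P);
  mu_natural : forall k (m : 'I_k.+2 -> int) (P Q : 'I_k.+2 -> cpair D)
    (f : forall l, pmor (P l) (Q l)) (x : forall l, hobj h (m l) (Q l)),
    hpull h (\sum_l m l) (prod_pmor f) (mu x) =
    mu (fun l => hpull h (m l) (f l) (x l));
  mu_comm : forall k (m : 'I_k.+2 -> int) (P : 'I_k.+2 -> cpair D)
    (i j : 'I_k.+2), i != j -> forall x : (forall l, hobj h (m l) (P l)),
    mu x = (-1) ^+ absz (m i * m j) *: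
      hpull h (\sum_l m l) (prod_swap P (tpermK i j))
        (cast_degree (sum_swap m i j)
          (@mu k (fun l => m (tperm i j l)) (fun l => P (tperm i j l))
            (fun l => x (tperm i j l))))
}.

Variable M : multiplicative.

Definition habs (n : int) (X : C) : lmodType K := hobj h n (absolute D X).

Definition cup k (Y : C) (m : 'I_k.+2 -> int) (x : forall l, habs (m l) Y) :
    habs (\sum_l m l) Y :=
  hpull h (\sum_l m l)
    (@from_abs _ _ _ _ _ D Y (prod_pair (fun _ : 'I_k.+2 => absolute D Y))
      (diagonal Lim k.+2 Y))
    (mu M (P := fun _ => absolute D Y) x).

(** The direct sum of all [h^n(X)]: families with finite support. *)
Record hstar (X : C) := HStar {
  hcoef :> forall n, habs n X;
  hcoef_finite : finite_set [set n | hcoef n != 0]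
}.

Definition hstar0 (X : C) : hstar X.
Proof.
exists (fun n => 0); rewrite (_ : [set _ | _] = classical_sets.set0) //.
by apply/seteqP; split=> n //=; rewrite eqxx.
Defined.

Definition hstar_pull (X Y : C) (f : Mor X Y) (x : hstar Y) : hstar X.
Proof.
exists (fun n => hpull h n (abs_mor D f) (x n)).
apply: sub_finite_set (hcoef_finite x) => n /=.
by apply: contra_neq => ->; rewrite linear0.
Defined.

Definition hstar_ker (X Y : C) (f : Mor X Y) : set (hstar Y) :=
  [set x | hstar_pull f x = hstar0 X].

Definition in_degree (X : C) (m n : int) (x : habs m X) : habs n X :=
  match m =P n with ReflectT e => cast_degree e x | ReflectF _ => 0 end.

Definition cup_coef k (Y : C) (x : 'I_k.+2 -> hstar Y) (n : int) : habs n Y :=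
  \sum_(d \in [set: {ffun 'I_k.+2 -> int}])
    in_degree n (cup (m := d) (fun l => x l (d l))).

Lemma multilinear0 (T : eqType) (V : T -> lmodType K) (N : lmodType K)
    (F : (forall t, V t) -> N) (x : forall t, V t) t :
  multilinear F -> x t = 0 -> F x = 0.
Proof.
move=> FP xt0.
have ext (u : V t) : u = 0 -> F (dfwith x u) = F x.
  move=> u0; congr F; apply: functional_extensionality_dep => t'.
  by case: dfwithP => //; rewrite xt0.
have := FP x t 1 0 0; rewrite scaler0 addr0 scale1r !ext // => /esym.
by move/(canRL (addKr _)); rewrite addNr.
Qed.

Lemma cup_coef_finite k (Y : C) (x : 'I_k.+2 -> hstar Y) :
  finite_set [set n | cup_coef x n != 0].
Proof.
have /finite_seqP[s sE] :
    finite_set (\bigcup_(l in [set: 'I_k.+2]) [set n | x l n != 0]).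
  by apply: bigcup_finite => // l _; exact: hcoef_finite.
pose g (t : {ffun 'I_k.+2 -> seq_sub s}) := \sum_l val (t l).
apply: (@sub_finite_set _ _ (range g)); last first.
  by apply: finite_image; exact: finite_finset.
move=> n /= xn; apply: contrapT => nP; move/eqP: xn; apply.
apply: fsbig1 => d _; rewrite /in_degree; case: eqP => // dn.
have [[l ld]|dP] := pselect (exists l, x l (d l) = 0).
  case: _ / dn; rewrite /= /cup (multilinear0 (t := l) _ ld) ?linear0 //.
  exact: mu_multilinear.
have ds l : d l \in s.
  suff: [set` s] (d l) by [].
  by rewrite -sE; exists l => //=; apply/eqP => xl; apply: dP; exists l.
exfalso; apply: nP; exists [ffun l => SeqSub (ds l)] => //.
by rewrite /g -dn; apply: eq_bigr => l _; rewrite ffunE.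
Qed.

Definition hstar_cup k (Y : C) (x : 'I_k.+2 -> hstar Y) : hstar Y :=
  HStar (cup_coef_finite x).

(** The product of [n] elements; the empty product is never used. *)
Definition hstar_prod n (Y : C) : ('I_n -> hstar Y) -> hstar Y :=
  match n with
  | 0 => fun _ => hstar0 Y
  | 1 => fun x => x ord0
  | k.+2 => fun x => hstar_cup x
  end.

End Cohomology.
Arguments hstar_ker {C I Lim Colim J D R K} h {X Y} f.

Definition min_nat (S : set nat) : \bar int :=
  match pselect (exists n, `[< S n >]) with
  | left e => (ex_minn e)%:Z%:E
  | right _ => +oo%E
  end.

Section Invariants.
Variables (C : category) (I : initial C).
Variables (Lim : finite_limits C) (Colim : finite_colimits C) (J : covers C).
Variables (D : distinguished_class I Lim Colim J) (R : pair_relation D).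

Definition nil_index (K : comPzRingType) (h : cohomology_theory R K)
    (M : multiplicative h) (Y : C) (S : set (hstar h Y)) : \bar int :=
  min_nat [set n | (1 <= n)%N /\
    forall x : 'I_n -> hstar h Y, (forall l, S (x l)) ->
      hstar_prod M x = hstar0 h Y].

Definition Rsec (X Y : C) (f : Mor X Y) : \bar int :=
  min_nat [set m | (1 <= m)%N /\
    exists (A : 'I_m -> C) (g : forall j, Mor (A j) Y), covering J g /\
    exists s : forall j, Mor (A j) X,
      forall j, prel R (abs_mor D (f ∘ s j)) (abs_mor D (g j))].

End Invariants.

(* Main.v *)
Require Import Defs.
From mathcomp Require Import all_boot all_algebra.
From mathcomp Require Import constructive_ereal.
From mathcomp Require Import boolp classical_sets fsbigop.

(** If [f ∘ s_j R g_j] for a covering [g_1, ..., g_m] of [Y], then every class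
    killed by [f^*] is killed by each [g_j^*], hence lifts to the pair
    [(Y, Y_j)].  By naturality of [mu], a product of [m] such classes is the
    image of the relative product of the lifts, which lives in
    [h^*(Y, limtilde g) = 0]. *)

Set Implicit Arguments.
Unset Strict Implicit.
Unset Printing Implicit Defensive.

Import GRing.Theory Defs.

Local Open Scope classical_set_scope.
Local Open Scope ring_scope.
Local Open Scope cat_scope.

Lemma min_nat_le (S T : set nat) : S `<=` T -> (min_nat T <= min_nat S)%E.
Proof.
move=> ST; rewrite /min_nat; case: (pselect (exists n, `[< S n >])) => [eS|_].
  case: pselect => [eT|nT]; last first.
    by case: nT; case: eS => n /asboolP Sn; exists n; apply/asboolP/ST.
  rewrite lee_fin lez_nat; case: ex_minnP => m _ minm.
  by case: ex_minnP => n /asboolP Sn _; apply/minm/asboolP/ST.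
by rewrite leey.
Qed.

Section LimtildeMaps.
Context (C : category) (Lim : finite_limits C) (Colim : finite_colimits C).

Lemma phi1_factor (A : 'I_1 -> C) (X : C) (i : forall l, Mor (A l) X) :
  exists r, i ord0 ∘ r = phi Lim Colim i.
Proof.
pose u l : Mor (A l) (A ord0) :=
  eq_rect ord0 (fun j => Mor (A j) (A ord0)) (idm _) l (esym (ord1 l)).
have uP : is_cocone (D := source_diagram (lambda Lim i))
    (fun v => match v return Mor (dobj (source_diagram (lambda Lim i)) v) _ with
              | Some l => u l | None => lambda Lim i ord0 end).
  by move=> l /=; rewrite (cast_dom_comp _ _ (lambda Lim i)) comp1m.
exists (colim_desc (Colim _) uP); apply: limtilde_uniq => [l|]; rewrite -compA.
  rewrite phi_rho /rho (colim_descE _ uP (Some l)).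
  by apply: comp_cast_dom; rewrite compm1.
by rewrite phi_rho_star /rho_star (colim_descE _ uP None) lambdaE.
Qed.

Context (k : nat) (A : 'I_k -> C) (X : C) (i : forall l, Mor (A l) X).

Lemma diagonal_lift l :
  exists d, diagonal Lim k X ∘ i l = up_mor Lim i l ∘ d.
Proof.
have dP j : exists d, up_factor_mor i l j ∘ d = i l.
  rewrite /up_factor_mor /up_factor; case: eqP => [->|_].
    by exists (idm _); rewrite compm1.
  by exists (i l); rewrite comp1m.
exists (prod_tuple Lim (fun j => sval (cid (dP j)))).
apply: prod_uniq => j; rewrite !compA !prod_tupleE -compA prod_tupleE comp1m.
by case: (cid (dP j)).
Qed.

End LimtildeMaps.

Section CohomologyLemmas.
Context (C : category) (I : initial C).
Context (Lim : finite_limits C) (Colim : finite_colimits C) (J : covers C).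
Context (D : distinguished_class I Lim Colim J) (R : pair_relation D).
Context (K : comPzRingType) (h : cohomology_theory R K).

Lemma hpull_comp n (P Q S : cpair D) (g : pmor Q S) (f : pmor P Q)
    (x : hobj h n S) :
  hpull h n (pmor_comp g f) x = hpull h n f (hpull h n g x).
Proof.
rewrite /hpull -cls_comp.
by rewrite (fmap_comp (hfun h n) (rcls R f : @Mor (opposite (rpairs R)) Q P)
             (rcls R g : @Mor (opposite (rpairs R)) S Q)).
Qed.

Lemma hpull_rel n (P Q : cpair D) (f g : pmor P Q) :
  prel R f g -> hpull h n f = hpull h n g.
Proof. by move=> fg; rewrite /hpull (cls_eq fg). Qed.

Lemma abs_mor_comp (X Y Z : C) (g : Mor Y Z) (f : Mor X Y) :
  abs_mor D (g ∘ f) = pmor_comp (abs_mor D g) (abs_mor D f).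
Proof. by apply: pmor_eq => //=; rewrite comp1m. Qed.

Lemma from_absE (X : C) (Q : cpair D) (u : pmor (absolute D X) Q) :
  u = from_abs (pmap u : Mor X (ptotal Q)).
Proof. by apply: pmor_eq => //; apply: from_init_uniq. Qed.

Lemma hstar_eq (X : C) (x y : hstar h X) : (forall n, x n = y n) -> x = y.
Proof.
case: x y => [x xP] [y yP] /= xy.
have {xy} xy : x = y by apply: functional_extensionality_dep.
by move: yP; rewrite -xy => yP; rewrite (Prop_irrelevance xP yP).
Qed.

Lemma hstar_ker_coef (X Y : C) (f : Mor X Y) (x : hstar h Y) n :
  hstar_ker h f x -> hpull h n (abs_mor D f) (x n) = 0.
Proof. by move=> /(congr1 (fun z : hstar h X => z n)). Qed.

Lemma local_section_kills (X Y Z : C) (f : Mor X Y) (s : Mor Z X) (g : Mor Z Y)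
    n (x : habs h n Y) :
  prel R (abs_mor D (f ∘ s)) (abs_mor D g) ->
  hpull h n (abs_mor D f) x = 0 -> hpull h n (abs_mor D g) x = 0.
Proof.
by move=> /(hpull_rel n) <- fx0; rewrite abs_mor_comp hpull_comp fx0 linear0.
Qed.

Lemma cover1_eq0 (Y : C) (A : 'I_1 -> C) (g : forall l, Mor (A l) Y) n
    (x : habs h n Y) :
  covering J g -> hpull h n (abs_mor D (g ord0)) x = 0 -> x = 0.
Proof.
move=> cov gx0; have [r gr] := phi1_factor Lim Colim g.
have : hpull h n (abs_mor D (pincl (finite_cover_pair D cov))) x = 0.
  by rewrite /= -gr abs_mor_comp hpull_comp gx0 linear0.
by move=> /h_exact_total[y <-]; rewrite (h_cover y) linear0.
Qed.

Context (M : multiplicative h).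

Lemma cup_cover_eq0 k (Y : C) (A : 'I_k.+2 -> C) (g : forall l, Mor (A l) Y)
    (m : 'I_k.+2 -> int) (x : forall l, habs h (m l) Y) :
  covering J g -> (forall l, hpull h (m l) (abs_mor D (g l)) (x l) = 0) ->
  cup M x = 0.
Proof.
move=> cov gx0; pose P l := CPair (dist_cover D cov l).
have lift l : exists y, hpull h (m l) (pair_iota (P l)) y = x l.
  by have [lift _] := h_exact_total (P := P l) (x l); apply: lift (gx0 l).
pose y l := sval (cid (lift l)).
have yE l : hpull h (m l) (pair_iota (P l)) (y l) = x l by rewrite /y; case: cid.
have dP l := svalP (cid (diagonal_lift Lim g l)).
pose Delta : pmor (finite_cover_pair D cov) (prod_pair P) :=
  @PMor _ _ _ _ _ _ (finite_cover_pair D cov) (prod_pair P)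
    (diagonal Lim k.+2 Y) (xi Lim Colim dP) (esym (phi_xi Lim Colim dP)).
have -> : x = fun l => hpull h (m l) (pair_iota (P l)) (y l).
  by apply: functional_extensionality_dep => l; rewrite yE.
rewrite /cup -mu_natural -hpull_comp.
have -> : pmor_comp (prod_pmor (fun l => pair_iota (P l)))
    (from_abs (Q := prod_pair (fun=> absolute D Y)) (diagonal Lim k.+2 Y)) =
  pmor_comp Delta (pair_iota (finite_cover_pair D cov)).
  rewrite [LHS]from_absE [RHS]from_absE; congr from_abs => /=.
  rewrite compm1; apply: prod_uniq => l.
  by rewrite compA !prod_tupleE -compA prod_tupleE comp1m.
by rewrite hpull_comp [hpull _ _ Delta _]h_cover linear0.
Qed.

Lemma hstar_prod_cover_eq0 n (Y : C) (A : 'I_n -> C) (g : forall l, Mor (A l) Y)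
    (x : 'I_n -> hstar h Y) :
  covering J g ->
  (forall l d, hpull h d (abs_mor D (g l)) (x l d) = 0) ->
  hstar_prod M x = hstar0 h Y.
Proof.
case: n A g x => [|[|k]] A g x cov gx0 //=; apply: hstar_eq => n /=.
  exact: cover1_eq0 cov (gx0 ord0 n).
apply: fsbig1 => d _; rewrite /in_degree; case: eqP => // dn.
rewrite (cup_cover_eq0 cov) //; by case: _ / dn.
Qed.

End CohomologyLemmas.

Theorem theorem4p14 (C : category) (I : initial C)
  (Lim : finite_limits C) (Colim : finite_colimits C) (J : covers C)
  (D : distinguished_class I Lim Colim J) (R : pair_relation D)
  (K : comPzRingType) (h : cohomology_theory R K) (M : multiplicative h)
  (X Y : C) (f : Mor X Y) :
  (nil_index M (hstar_ker h f) <= Rsec R f)%E.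
Proof.
apply: min_nat_le => m [m1 [A [g [cov [s sP]]]]]; split=> // x xker.
apply: (hstar_prod_cover_eq0 M cov) => l d.
by apply: local_section_kills (sP l) _; apply: hstar_ker_coef.
Qed.
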